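(* Suppose $n>1$, let $S\subseteq\mathbb{F}_2^n$ and let $s=|S|$. Then \[ \mathcal{L}(S)\ \ge\ \left(\frac{2^n(3s-2)-s^3}{2^n-s}\right)^{1/2}, \] with equality if and only if $S$ is Sidon and $\widehat{1_S}(a)\in\{0,\pm\mathcal{L}(S)\}$ for all $a\in\mathbb{F}_2^n\setminus\{0\}$.
   Context: $\widehat{1_S}(a)=\sum_{x\in S}(-1)^{x\cdot a}$ (standard dot product) is the Fourier transform of $S$, and the linearity of $S$ is $\mathcal{L}(S)=\max_{a\in\mathbb{F}_2^n\setminus\{0\}}|\widehat{1_S}(a)|$. A set $S\subseteq\mathbb{F}_2^n$ is a Sidon set if whenever $a+b=c+d$ with $a,b,c,d\in S$, $a\neq b$, $c\neq d$, then $\{a,b\}=\{c,d\}$.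
   Formalization: The case S = F_2^n is excluded, since there the denominator 2^n − s is 0 and the bound is undefined; when the quantity under the root is negative (for example s = 0), where no real square root exists, the root is read as 0. *)

(* Defs.v *)
From HB Require Import structures.
From mathcomp Require Import all_boot all_order all_algebra.

Set Implicit Arguments.
Unset Strict Implicit.
Unset Printing Implicit Defensive.

Import Order.TTheory GRing.Theory Num.Theory.
Local Open Scope ring_scope.

Definition dotF2 (n : nat) (x a : 'rV['F_2]_n) : 'F_2 :=
  \sum_(i < n) x 0 i * a 0 i.

(* The exponent is the representative of x . a in {0, 1}. *)
Definition fourier (n : nat) (S : {set 'rV['F_2]_n}) (a : 'rV['F_2]_n) : int :=
  \sum_(x in S) (-1) ^+ (dotF2 x a : nat).

(* Fourier coefficients are integers, so the maximum of their absolute values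
   is a natural number; for n > 0 it ranges over a nonempty set. *)
Definition linearity (n : nat) (S : {set 'rV['F_2]_n}) : nat :=
  \max_(a : 'rV['F_2]_n | a != 0) `|fourier S a|%N.

Definition sidon (n : nat) (S : {set 'rV['F_2]_n}) : Prop :=
  forall a b c d : 'rV['F_2]_n,
    a \in S -> b \in S -> c \in S -> d \in S ->
    a + b = c + d -> a != b -> c != d ->
    [set a; b] = [set c; d].

(* Num.sqrt is 0 on negative arguments, so a negative radicand (which occurs for
   s = 0 and for large s) gives the bound 0. The quotient is meaningful only
   for s < 2 ^ n. *)
Definition linearity_bound (R : rcfType) (n s : nat) : R :=
  Num.sqrt ((2 ^+ n * (3 * s%:R - 2) - s%:R ^+ 3) / (2 ^+ n - s%:R)).

(* Main.v *)
(* Write f for the Fourier transform of S, L for its linearity and E for the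
   number of (x, y, z) in S^3 with x + y + z in S.  Orthogonality of characters
   gives sum_a f(a)^2 = 2^n s and sum_a f(a)^4 = 2^n E, and f(0) = s, so that
     s ((2^n - s) L^2 - (2^n (3 s - 2) - s^3))
       = sum_(a != 0) f(a)^2 (L^2 - f(a)^2) + 2^n (E - (3 s^2 - 2 s)).
   Both terms on the right are nonnegative; the first vanishes iff f takes its
   values in {0, L, -L} off 0, the second iff S is Sidon, because for x != y
   in S the elements z = x and z = y always satisfy x + y + z \in S, and there
   are no others exactly when S is Sidon. *)
Require Import Defs.
From HB Require Import structures.
From mathcomp Require Import all_boot all_order all_algebra.
From mathcomp Require Import ring lra.

Set Implicit Arguments.
Unset Strict Implicit.
Unset Printing Implicit Defensive.

Import Order.TTheory GRing.Theory Num.Theory.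
Local Open Scope ring_scope.

(** * Characteristic 2 and the characters of the group *)

Lemma addvv_F2 (n : nat) (x : 'rV['F_2]_n) : x + x = 0.
Proof. by rewrite -mulr2n -scaler_nat pchar_Fp_0 // scale0r. Qed.

Lemma oppv_F2 (n : nat) (x : 'rV['F_2]_n) : - x = x.
Proof. by apply/eqP; rewrite eq_sym -addr_eq0 addvv_F2. Qed.

(** The exponent on the left is reduced modulo 2, which a power of -1 does not see. *)
Lemma signD_F2 (u v : 'F_2) :
  (-1) ^+ ((u + v)%R : nat) = (-1) ^+ (u : nat) * (-1) ^+ (v : nat) :> int.
Proof. by case: u => [[|[|u]] hu]; case: v => [[|[|v]] hv]. Qed.

Section Character.
Variable n : nat.
Implicit Types x y a b : 'rV['F_2]_n.

Definition character x a : int := (-1) ^+ (dotF2 x a : nat).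

Lemma characterDl x y a : character (x + y) a = character x a * character y a.
Proof.
rewrite /character -signD_F2; congr (_ ^+ nat_of_ord _).
by rewrite /dotF2 -big_split; apply: eq_bigr => i _; rewrite mxE mulrDl.
Qed.

Lemma characterC x a : character x a = character a x.
Proof.
by congr (_ ^+ nat_of_ord _); apply: eq_bigr => i _; rewrite mulrC.
Qed.

Lemma character0 a : character 0 a = 1.
Proof. by rewrite /character /dotF2 big1 // => i _; rewrite mxE mul0r. Qed.

Lemma character_delta x i : x 0 i != 0 -> character x (delta_mx 0 i) = -1.
Proof.
have -> : character x (delta_mx 0 i) = (-1) ^+ (x 0 i : nat).
  congr (_ ^+ nat_of_ord _); rewrite /dotF2 (bigD1 i) //= mxE !eqxx mulr1.
  by rewrite big1 ?addr0 // => j ji; rewrite mxE (negPf ji) andbF mulr0.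
by case: (x 0 i) => [[|[|k]] hk].
Qed.

(** Orthogonality: if coordinate [i] of [x] is nonzero, translating [a] by the [i]-th unit vector
    flips every sign, so the sum is its own negative. *)
Lemma sum_character x : \sum_a character x a = (2 ^ n * (x == 0%R))%N%:R.
Proof.
have [->|/rV0Pn[i xi]] := eqVneq x 0.
  rewrite (eq_bigr (fun=> 1)) => [|a _]; last exact: character0.
  by rewrite sumr_const card_mx card_Fp // mul1n muln1.
rewrite muln0; set t := \sum_a _.
suff : t = - t by move=> tN; lra.
rewrite {1}/t (reindex_inj (addIr (delta_mx 0 i))) -sumrN.
apply: eq_bigr => a _.
by rewrite characterC characterDl !(characterC _ x) character_delta // mulrN1.
Qed.

End Character.

(** * Second and fourth moments of the Fourier transform *)

Section Moments.
Variables (n : nat) (S : {set 'rV['F_2]_n}).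
Implicit Types x y z a : 'rV['F_2]_n.

Definition completions x y : {set 'rV['F_2]_n} := [set z in S | x + y + z \in S].

Lemma fourier0 : fourier S 0 = #|S|%:R.
Proof.
rewrite -sumr_const; apply: eq_bigr => x _.
by rewrite -/(character x 0) characterC character0.
Qed.

(** Fourier inversion: after exchanging sums, orthogonality at [x + y] keeps only [y = x]. *)
Lemma sum_character_fourier x :
  \sum_a character x a * fourier S a = (2 ^ n * (x \in S))%N%:R.
Proof.
under eq_bigr do rewrite mulr_sumr.
rewrite exchange_big /=.
under eq_bigr => y _.
  under eq_bigr do rewrite -/(character y _) -characterDl.
  rewrite sum_character addr_eq0 oppv_F2 eq_sym.
over.
rewrite -natr_sum -big_distrr /=; congr (_ * _)%N%:R.
have [xS|xS] := boolP (x \in S).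
  by rewrite (bigD1 x) //= eqxx big1 // => y /andP[_ /negPf->].
by rewrite big1 // => y yS; case: eqP => // yx; rewrite -yx yS in xS.
Qed.

Lemma sum_fourier2 : \sum_a fourier S a ^+ 2 = (2 ^ n * #|S|)%N%:R.
Proof.
under eq_bigr do rewrite expr2 {1}/fourier mulr_suml.
rewrite exchange_big /=.
under eq_bigr => x xS do rewrite sum_character_fourier xS muln1.
by rewrite sumr_const natrM mulr_natr.
Qed.

Lemma sum_fourier4 :
  \sum_a fourier S a ^+ 4
  = (2 ^ n * \sum_(x in S) \sum_(y in S) #|completions x y|)%N%:R.
Proof.
(* Only three factors are expanded; inversion applied to the fourth tests whether [x + y + z] lies
   in [S]. *)
have f4 a : fourier S a ^+ 4 = \sum_(x in S) \sum_(y in S) \sum_(z in S)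
    character (x + y + z) a * fourier S a.
  rewrite !exprS expr0 mulr1 {1}/fourier mulr_suml; apply: eq_bigr => x _.
  rewrite {1}/fourier mulr_suml mulr_sumr; apply: eq_bigr => y _.
  rewrite {1}/fourier mulr_suml !mulr_sumr; apply: eq_bigr => z _.
  by rewrite !characterDl /character; ring.
rewrite (eq_bigr _ (fun a _ => f4 a)).
rewrite exchange_big big_distrr natr_sum; apply: eq_bigr => x _ /=.
rewrite exchange_big big_distrr natr_sum; apply: eq_bigr => y _ /=.
rewrite exchange_big /=.
under eq_bigr do rewrite sum_character_fourier.
rewrite -natr_sum -big_distrr /=; congr (_ * _)%N%:R.
by rewrite -big_mkcondr -sum1_card; apply: eq_bigl => z; rewrite inE.
Qed.

(** * Sidon sets through completions *)

Lemma completions_diag x : completions x x = S.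
Proof. by apply/setP=> z; rewrite inE addvv_F2 add0r andbb. Qed.

Lemma sub_completions x y : x \in S -> y \in S -> [set x; y] \subset completions x y.
Proof.
move=> xS yS; apply/subsetP=> z; rewrite !inE => /orP[]/eqP->.
  by rewrite xS addrAC addvv_F2 add0r.
by rewrite yS -addrA addvv_F2 addr0.
Qed.

Lemma sidonP :
  sidon S <-> forall x y, x \in S -> y \in S -> x != y -> #|completions x y| = 2%N.
Proof.
split=> [sidS x y xS yS xy | h2 a b c d aS bS cS dS abcd ab cd].
  suff -> : completions x y = [set x; y] by rewrite cards2 xy.
  apply/eqP; rewrite eqEsubset sub_completions // andbT.
  apply/subsetP=> z; rewrite inE => /andP[zS wS].
  rewrite (sidS x y z (x + y + z)) ?set21 //.
    by rewrite addrCA addvv_F2 addr0.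
  (* [z] and [x + y + z] differ by [x + y], which is nonzero since [x != y]. *)
  by rewrite -subr_eq0 opprD addrCA subrr addr0 oppr_eq0 addr_eq0 oppv_F2.
have sub u : u \in S -> a + b + u \in S -> u \in [set a; b].
  move=> uS wS; suff -> : [set a; b] = completions a b by rewrite inE uS.
  by apply/eqP; rewrite eqEcard sub_completions // h2 // cards2 ab.
apply/esym/eqP; rewrite eqEcard !cards2 ab cd leqnn andbT.
apply/subsetP=> u; rewrite in_set2 => /orP[]/eqP->; apply: sub => //.
  by rewrite abcd addrAC addvv_F2 add0r.
by rewrite abcd -addrA addvv_F2 addr0.
Qed.

(** The truncated subtraction loses nothing: for [x != y] in [S], both [x] and [y] are completions.
    The diagonal is left out because its completions are all of [S], Sidon or not. *)
Definition sidon_excess : nat :=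
  \sum_(x in S) \sum_(y in S | y != x) (#|completions x y| - 2).

Lemma sidon_excess_eq0 : sidon_excess = 0%N <-> sidon S.
Proof.
rewrite sidonP; split=> [/eqP | h2].
  rewrite sum_nat_eq0 => /forall_inP e0 x y xS yS xy.
  have := e0 x xS; rewrite sum_nat_eq0 => /forall_inP/(_ y).
  rewrite yS eq_sym xy subn_eq0 => /(_ isT) le2; apply/eqP.
  rewrite eqn_leq le2.
  by rewrite (leq_trans _ (subset_leq_card (sub_completions xS yS))) // cards2 xy.
rewrite /sidon_excess big1 // => x xS; rewrite big1 // => y /andP[yS yx].
by rewrite h2 // eq_sym.
Qed.

(** In the row of [x], the diagonal gives [s] and the [s - 1] other entries give 2 each plus their
    excess, hence [3 s - 2] plus the excess of the row. *)
Lemma sum_completions :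
  (\sum_(x in S) \sum_(y in S) #|completions x y|)%:R
  = 3 * #|S|%:R ^+ 2 - 2 * #|S|%:R + sidon_excess%:R :> int.
Proof.
have row x : x \in S -> (\sum_(y in S) #|completions x y|)%:R
    = 3 * #|S|%:R - 2
      + (\sum_(y in S | y != x) (#|completions x y| - 2))%:R :> int.
  move=> xS; rewrite (bigD1 x) //= completions_diag natrD.
  rewrite (eq_bigr (fun y => (#|completions x y| - 2) + 2)%N) => [|y /andP[yS yx]].
    rewrite big_split natrD /= sum_nat_const.
    have -> : #|[pred y in S | y != x]| = #|S :\ x|.
      by apply: eq_card => y; rewrite !inE andbC.
    have -> : #|S|%:R = 1 + #|S :\ x|%:R :> int by rewrite (cardsD1 x) xS natrD.
    by rewrite natrM; ring.
  rewrite subnK // (leq_trans _ (subset_leq_card (sub_completions xS yS))) //.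
  by rewrite cards2 eq_sym yx.
rewrite natr_sum (eq_bigr _ row) big_split sumr_const /= -natr_sum -mulr_natr.
by rewrite /sidon_excess; ring.
Qed.

(** * Flatness of the spectrum off 0 and the gap identity *)

Lemma fourier_le_linearity a : a != 0 -> `|fourier S a| <= (linearity S)%:R.
Proof.
move=> a0; rewrite -abszE natz lez_nat /linearity.
exact: (@leq_bigmax_cond _ _ (fun b => `|fourier S b|%N) a a0).
Qed.

Lemma sum_fourier2_neq0 :
  \sum_(a | a != 0) fourier S a ^+ 2 = #|S|%:R * (2 ^+ n - #|S|%:R).
Proof.
have := sum_fourier2; rewrite (bigD1 0) //= fourier0 natrM natrX => e.
by apply: (addrI (#|S|%:R ^+ 2)); rewrite e; ring.
Qed.

Definition flatness_defect : int :=
  \sum_(a | a != 0) fourier S a ^+ 2 * ((linearity S)%:R ^+ 2 - fourier S a ^+ 2).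

Lemma flatness_term_ge0 a : a != 0 ->
  0 <= fourier S a ^+ 2 * ((linearity S)%:R ^+ 2 - fourier S a ^+ 2).
Proof.
move=> a0; rewrite mulr_ge0 ?sqr_ge0 // subr_ge0 -[_ ^+ 2]real_normK ?num_real //.
by rewrite lerXn2r ?nnegrE ?fourier_le_linearity.
Qed.

Lemma flatness_defect_ge0 : 0 <= flatness_defect.
Proof. exact: sumr_ge0 flatness_term_ge0. Qed.

Lemma flatness_defect_eq0 :
  flatness_defect = 0 <->
  (forall a, a != 0 ->
     fourier S a \in [:: 0; (linearity S)%:Z; - (linearity S)%:Z]).
Proof.
have termE a : (fourier S a ^+ 2 * ((linearity S)%:R ^+ 2 - fourier S a ^+ 2) == 0)
    = (fourier S a \in [:: 0; (linearity S)%:Z; - (linearity S)%:Z]).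
  by rewrite mulf_eq0 sqrf_eq0 subr_eq0 eq_sym [X in _ || X]eq_sym eqf_sqr !inE natz
             [0 == _]eq_sym.
split=> [/eqP | h].
  rewrite psumr_eq0; last exact: flatness_term_ge0.
  by move=> /allP h a a0; have := h a (mem_index_enum a); rewrite a0 termE.
by rewrite /flatness_defect big1 // => a a0; apply/eqP; rewrite termE h.
Qed.

(** Removing the terms at [a = 0], namely [s ^ 2] and [s ^ 4], from the two moments gives the
    identity; with denominators cleared it stays in the integers. *)
Lemma linearity_gap :
  #|S|%:R * ((2 ^+ n - #|S|%:R) * (linearity S)%:R ^+ 2
             - (2 ^+ n * (3 * #|S|%:R - 2) - #|S|%:R ^+ 3))
  = flatness_defect + 2 ^+ n * sidon_excess%:R.
Proof.
have := sum_fourier4; rewrite (bigD1 0) //= fourier0 natrM natrX sum_completions => e4.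
rewrite /flatness_defect.
under eq_bigr => a _ do rewrite mulrBr -exprD mulrC.
rewrite sumrB -mulr_sumr sum_fourier2_neq0.
have -> : \sum_(a | a != 0) fourier S a ^+ (2 + 2)
  = 2 ^+ n * (3 * #|S|%:R ^+ 2 - 2 * #|S|%:R + sidon_excess%:R) - #|S|%:R ^+ 4.
  by rewrite -e4 addrAC subrr add0r.
by ring.
Qed.

End Moments.

Theorem theorem3p4 (R : rcfType) (n : nat) (hn : (1 < n)%N)
    (S : {set 'rV['F_2]_n}) (hS : (#|S| < 2 ^ n)%N) :
  linearity_bound R n #|S| <= (linearity S)%:R /\
  ((linearity S)%:R = linearity_bound R n #|S| <->
   sidon S /\
   (forall a : 'rV['F_2]_n, a != 0 ->
      fourier S a \in [:: 0; (linearity S)%:Z; - (linearity S)%:Z])).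
Proof.
rewrite -sidon_excess_eq0 -flatness_defect_eq0 /linearity_bound.
have gap := linearity_gap S; have F0 := flatness_defect_ge0 S.
have p2 : 0 < 2 ^+ n :> int by rewrite exprn_gt0.
have qR : 0 < 2 ^+ n - #|S|%:R :> R by rewrite subr_gt0 -natrX ltr_nat.
have qZ : 0 < 2 ^+ n - #|S|%:R :> int by rewrite subr_gt0 -natrX ltr_nat.
have D0 : 0 <= 2 ^+ n * (sidon_excess S)%:R :> int by rewrite mulr_ge0 // ltW.
(* Both summands are nonnegative, so the two equality conditions merge into one: the gap is 0. *)
have gap0 : (sidon_excess S = 0%N /\ flatness_defect S = 0) <->
    flatness_defect S + 2 ^+ n * (sidon_excess S)%:R = 0.
  split=> [[-> ->]|/eqP]; first by rewrite mulr0 addr0.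
  rewrite paddr_eq0 // mulf_eq0 (gt_eqF p2) /= => /andP[/eqP-> ].
  by rewrite pnatr_eq0 => /eqP.
have gap_ge0 := addr_ge0 F0 D0.
rewrite gap0 -{}gap {F0 D0 gap0} in gap_ge0 *.
set r := (X in Num.sqrt X).
(* The factor [s] of the gap cancels only for nonempty [S]. For empty [S] the radicand is negative,
   so the bound is 0 by the convention on [Num.sqrt], as is the linearity. *)
have [s0|s0] := posnP #|S|.
  have L0 : linearity S = 0%N.
    rewrite /linearity big1 // => a _.
    by rewrite (cards0_eq s0) /fourier big_set0.
  have r0 : r <= 0.
    rewrite /r s0 pmulr_lle0 ?invr_gt0 -?[0%:R]s0 //; last by move: qR; rewrite s0.
    by rewrite mulr0 sub0r expr0n subr0 mulrN oppr_le0 mulr_ge0 // exprn_ge0.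
  by rewrite ler0_sqrtr // L0 s0 mul0r.
set g := _ - (_ - _) in gap_ge0 *.
have sZ : 0 < #|S|%:R :> int by rewrite ltr0n.
(* Passage from integers to [R]: the gap has the sign of [L ^ 2 - r], as [2 ^ n - s] is positive. *)
have gR : g%:~R = (2 ^+ n - #|S|%:R) * ((linearity S)%:R ^+ 2 - r) :> R.
  rewrite mulrBr [_ * r]mulrC divfK ?gt_eqF // /g.
  by rewrite !(rmorphB, rmorphM, rmorphXn, rmorph_nat).
have g_eq0 : (#|S|%:R * g = 0) <-> (linearity S)%:R ^+ 2 = r.
  split=> [/eqP|e].
    rewrite mulf_eq0 (gt_eqF sZ) /= => /eqP g0; move/esym/eqP: gR.
    by rewrite g0 mulr0z mulf_eq0 (gt_eqF qR) subr_eq0 => /eqP.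
  by move/eqP: gR; rewrite e subrr mulr0 intr_eq0 => /eqP->; rewrite mulr0.
rewrite g_eq0; split.
  rewrite -[leRHS]ger0_norm // -sqrtr_sqr ler_wsqrtr // -subr_ge0 -(pmulr_rge0 _ qR).
  by rewrite -gR ler0z -(pmulr_rge0 _ sZ).
split=> [Lr|<-]; last by rewrite sqrtr_sqr ger0_norm.
(* Squaring the root returns [r] only if [r] is nonnegative; a negative [r] would make the linearity
   0, which is then refuted. *)
have [r0|r0] := leP 0 r; first by rewrite Lr sqr_sqrtr.
have L0 : linearity S = 0%N.
  by apply/eqP; rewrite -(pnatr_eq0 R) Lr ler0_sqrtr ?ltW.
(* A nonempty proper subset has a nonzero Fourier coefficient off 0. *)
have := mulr_gt0 sZ qZ; rewrite -sum_fourier2_neq0 big1 ?ltxx // => a a0.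
apply/eqP; rewrite sqrf_eq0 -normr_le0.
by have := fourier_le_linearity S a0; rewrite L0.
Qed.
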